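(* Let $\mathcal{I}_{\mathcal{G}}$ be an unknown self-reducible sampler and $\mathcal{I}_{\mathcal{W}}$ a known self-reducible sampler with output range $\{0,1\}^n$, $\psi$ an input, $\varepsilon\in(0,1)$ a closeness parameter, $\eta\in(0,1)$ a farness parameter with $\eta>\varepsilon$, and $\delta\in(0,1)$ a confidence parameter. There exists an $(\varepsilon,\eta,\delta)$-identity tester for self-reducible samplers (namely $\mathsf{CubeProbeTester}$) that takes $\widetilde{\mathcal{O}}\big(n^2/(\eta-\varepsilon)^4\big)$ samples.
   Context: A sampler $\mathcal{I}$ is a randomized algorithm that on input $\psi\in\{0,1\}^m$ outputs an element of $\{0,1\}^n$; $\mathcal{D}^{\mathcal{I},\psi}$ denotes its output distribution. A sampler $\mathcal{I}_{\mathcal{W}}$ is known if $\mathcal{D}^{\mathcal{I}_{\mathcal{W}},\psi}(x)$ is explicitly available for all $\psi,x$. A sampler $\mathcal{I}$ is self-reducible if for every input $\psi$, every $i$ and every $b_1\dots b_i\in\{0,1\}^i$ there is an input $\widehat\psi=\mathsf{SubCond}(\psi,b_1\dots b_i)$ with $\mathcal{D}^{\mathcal{I},\widehat\psi}$ equal to $\mathcal{D}^{\mathcal{I},\psi}$ conditioned on $x_1=b_1,\dots,x_i=b_i$ (uniform on the subcube if the event has probability $0$). $\mathsf{d}^{\psi}_{\mathrm{TV}}(\mathcal{I}_{\mathcal{G}},\mathcal{I}_{\mathcal{W}})=\max_{A\subseteq\{0,1\}^n}\{\mathcal{D}^{\mathcal{I}_{\mathcal{G}},\psi}(A)-\mathcal{D}^{\mathcal{I}_{\mathcal{W}},\psi}(A)\}$.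 $\mathcal{I}_{\mathcal{G}}$ is $\varepsilon$-close to $\mathcal{I}_{\mathcal{W}}$ on $\psi$ if this distance is $\le\varepsilon$ and $\eta$-far if it is $\ge\eta$. An $(\varepsilon,\eta,\delta)$-identity tester, given $\mathcal{I}_{\mathcal{G}},\mathcal{I}_{\mathcal{W}},\psi,\varepsilon,\eta,\delta$, with probability at least $1-\delta$ outputs ACCEPT if $\mathcal{I}_{\mathcal{G}}$ is $\varepsilon$-close to $\mathcal{I}_{\mathcal{W}}$ on $\psi$ and outputs REJECT if $\mathcal{I}_{\mathcal{G}}$ is $\eta$-far from $\mathcal{I}_{\mathcal{W}}$ on $\psi$. Samples are samples drawn from $\mathcal{I}_{\mathcal{G}}$ (on any inputs); $\widetilde{\mathcal{O}}$ hides polylogarithmic factors. *)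

(* Defs.v *)
From HB Require Import structures.
From mathcomp Require Import all_boot all_order all_algebra.
From mathcomp Require Import reals exp.

Set Implicit Arguments.
Unset Strict Implicit.
Unset Printing Implicit Defensive.

Import Order.TTheory GRing.Theory Num.Theory.
Local Open Scope ring_scope.

Record fdist (R : realType) (T : finType) := FDist {
  pmf :> T -> R;
  pmf_ge0 : forall x, 0 <= pmf x;
  pmf_sum1 : \sum_x pmf x = 1 }.

Definition Pr (R : realType) (T : finType) (D : fdist R T) (A : {set T}) : R :=
  \sum_(x in A) D x.

(* A randomized algorithm used only as a source of independent samples is
   identified with the family of its output distributions. *)
Definition sampler (R : realType) (n m : nat) :=
  m.-tuple bool -> fdist R (n.-tuple bool).

Definition subcube (n : nat) (b : seq bool) : {set n.-tuple bool} :=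
  [set x : n.-tuple bool | prefix b x].

Definition cond_subcube (R : realType) (n : nat)
    (D : fdist R (n.-tuple bool)) (b : seq bool) (x : n.-tuple bool) : R :=
  if x \notin subcube n b then 0
  else if Pr D (subcube n b) == 0 then #|subcube n b|%:R^-1
  else D x / Pr D (subcube n b).

Record sr_sampler (R : realType) (n m : nat) := SRSampler {
  sr_dist :> sampler R n m;
  SubCond : m.-tuple bool -> seq bool -> m.-tuple bool;
  SubCondP : forall (psi : m.-tuple bool) (b : seq bool) (x : n.-tuple bool),
    (size b <= n)%N ->
    sr_dist (SubCond psi b) x = cond_subcube (sr_dist psi) b x }.

(* The neutral element 0 is the value at A = set0, so this is the maximum. *)
Definition dTV (R : realType) (n m : nat) (G W : sampler R n m)
    (psi : m.-tuple bool) : R :=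
  \big[Num.max/0]_(A : {set n.-tuple bool}) (Pr (G psi) A - Pr (W psi) A).

Definition close (R : realType) (n m : nat) (eps : R) (G W : sampler R n m)
    (psi : m.-tuple bool) : Prop := dTV G W psi <= eps.

Definition far (R : realType) (n m : nat) (eta : R) (G W : sampler R n m)
    (psi : m.-tuple bool) : Prop := eta <= dTV G W psi.

Inductive verdict := ACCEPT | REJECT.

(* Adaptive randomized procedures with black-box access to an unknown
   self-reducible sampler: they may flip a fair coin, draw a sample from the
   unknown sampler on any input, or evaluate its SubCond map; only draws are
   counted as samples. *)
Inductive procedure (n m : nat) : Type :=
| Output of verdict
| Flip of (bool -> procedure n m)
| Draw of m.-tuple bool & (n.-tuple bool -> procedure n m)
| AskSubCond of m.-tuple bool & seq bool & (m.-tuple bool -> procedure n m).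

Definition verdict_eqb (u v : verdict) : bool :=
  match u, v with
  | ACCEPT, ACCEPT | REJECT, REJECT => true
  | _, _ => false
  end.

(* Probability that p outputs v when run with access to G; fresh draws and coin
   flips are independent. *)
Fixpoint prob_output (R : realType) (n m : nat) (G : sr_sampler R n m)
    (v : verdict) (p : procedure n m) {struct p} : R :=
  match p with
  | Output u => (verdict_eqb u v)%:R
  | Flip k => (prob_output G v (k true) + prob_output G v (k false)) / 2
  | Draw phi k => \sum_(x : n.-tuple bool) sr_dist G phi x * prob_output G v (k x)
  | AskSubCond phi b k => prob_output G v (k (SubCond G phi b))
  end.

(* Worst case over coin flips and over all answers. *)
Fixpoint num_samples (n m : nat) (p : procedure n m) : nat :=
  match p with
  | Output _ => 0%N
  | Flip k => maxn (num_samples (k true)) (num_samples (k false))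
  | Draw _ k => ((\max_(x : n.-tuple bool) num_samples (k x)).+1)%N
  | AskSubCond _ _ k => (\max_(phi : m.-tuple bool) num_samples (k phi))%N
  end.

(* The known sampler W is an explicit argument; the unknown sampler is not, and
   is only reachable through the oracle nodes of the resulting procedure. *)
Definition tester (R : realType) (n m : nat) :=
  sr_sampler R n m -> m.-tuple bool -> procedure n m.

Definition identity_tester (R : realType) (n m : nat) (eps eta delta : R)
    (T : tester R n m) : Prop :=
  forall (G W : sr_sampler R n m) (psi : m.-tuple bool),
    (close eps G W psi -> 1 - delta <= prob_output G ACCEPT (T W psi)) /\
    (far eta G W psi -> 1 - delta <= prob_output G REJECT (T W psi)).

(* Main.v *)
Require Import Defs.
From mathcomp Require Import all_boot all_order all_algebra.
From mathcomp Require Import reals sequences exp.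
From mathcomp Require Import ring lra.

Set Implicit Arguments.
Unset Strict Implicit.
Unset Printing Implicit Defensive.

Import Order.TTheory GRing.Theory Num.Theory.
Local Open Scope ring_scope.

(** With P = G psi and Q = W psi, the distance is the mean over x ~ P of the
    positive part of 1 - Q x / P x.  The unknown P x is estimated by the
    product, over the coordinates i, of the empirical frequency of the bit x_i
    among N draws from P conditioned on x_1 .. x_(i-1).  A bit of conditional
    probability p contributes a factor at most 1 + 1 / (p N) to the relative
    second moment; this is unbounded in p, but averaging over the bit itself
    cancels 1 / p, so that the chi-square error of the product, averaged over
    x ~ P, is at most (1 + 2 / N)^n - 1 whatever P is.  This error bounds the
    squared bias, so N = O(n / gap^2) draws per coordinate, gap = eta - eps,
    make the bias at most gap / 4, and the mean of O(ln (1 / delta) / gap^2)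
    independent trials in [0, 1] is within gap / 2 of the distance with
    probability 1 - delta. *)

Section ExponentialBounds.
Variable R : realType.

Lemma expR_le1DxD2sqr (x : R) : x <= 2^-1 -> expR x <= 1 + x + 2 * x ^+ 2.
Proof.
move=> x_le; have expR_le : expR x * (1 - x) <= 1.
  by rewrite -ler_pdivlMl ?expR_gt0 // mulr1 -expRN expR_ge1Dx.
rewrite -(@ler_pM2r _ (1 - x)); last by lra.
apply: le_trans expR_le _.
have -> : (1 + x + 2 * x ^+ 2) * (1 - x) = 1 + x ^+ 2 * (1 - 2 * x) by ring.
by rewrite lerDl mulr_ge0 ?sqr_ge0 //; lra.
Qed.

Lemma expr1D_le (x : R) k :
  0 <= x -> k%:R * x <= 2^-1 -> (1 + x) ^+ k <= 1 + 2 * (k%:R * x).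
Proof.
move=> x_ge0 kx_le; have kx_ge0 : 0 <= k%:R * x by rewrite mulr_ge0.
apply: (@le_trans _ _ (expR (k%:R * x))).
  by rewrite expRM_natl lerXn2r ?nnegrE ?expR_ge0 ?addr_ge0 // expR_ge1Dx.
apply: le_trans (expR_le1DxD2sqr kx_le) _.
have := ler_wpM2l kx_ge0 kx_le; lra.
Qed.

Lemma ln_ge_half (y : R) : 2 <= y -> 2^-1 <= ln y.
Proof.
move=> y_ge2; have ln2_le : ln 2 <= ln y by rewrite ler_ln ?posrE //; lra.
have := @expR_ge1Dx R (- ln 2); rewrite expRN lnK ?posrE //; lra.
Qed.

End ExponentialBounds.

Section FiniteDistributions.
Variables (R : realType) (T : finType) (D : fdist R T).

Lemma Pr_ge0 (A : {set T}) : 0 <= Pr D A.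
Proof. by apply: sumr_ge0 => x _; apply: pmf_ge0. Qed.

Lemma Pr_setT : Pr D setT = 1.
Proof. by rewrite -(pmf_sum1 D); apply: eq_bigl => x; rewrite inE. Qed.

Lemma Pr_set1 x : Pr D [set x] = D x.
Proof. exact: big_set1. Qed.

Lemma le_Pr (A B : {set T}) : A \subset B -> Pr D A <= Pr D B.
Proof.
move=> /subsetP AB; rewrite /Pr [leLHS]big_mkcond [leRHS]big_mkcond.
apply: ler_sum => x _; case: ifP => [/AB -> //|_].
by case: ifP => // _; apply: pmf_ge0.
Qed.

Lemma Pr_setC (A : {set T}) : Pr D A + Pr D (~: A) = 1.
Proof. by rewrite -Pr_setT /Pr [RHS](big_setID A) setTI setTD. Qed.

Lemma Pr_indicator (A : {set T}) : \sum_x D x * (x \in A)%:R = Pr D A.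
Proof.
rewrite [RHS]big_mkcond; apply: eq_bigr => x _.
by rewrite mulr_natr mulrb.
Qed.

End FiniteDistributions.

Section Programs.
Variables n m : nat.

(* The deterministic fragment of [procedure], with outputs of an arbitrary type
   so that programs can be composed. *)
Inductive prog (A : Type) : Type :=
| Ret of A
| PDraw of m.-tuple bool & (n.-tuple bool -> prog A)
| PAskSubCond of m.-tuple bool & seq bool & (m.-tuple bool -> prog A).

Fixpoint bind A B (p : prog A) (q : A -> prog B) : prog B :=
  match p with
  | Ret a => q a
  | PDraw phi k => PDraw phi (fun x => bind (k x) q)
  | PAskSubCond phi b k => PAskSubCond phi b (fun chi => bind (k chi) q)
  end.

Definition prog_map A B (f : A -> B) (p : prog A) : prog B :=
  bind p (fun a => Ret (f a)).

Definition draw (phi : m.-tuple bool) : prog (n.-tuple bool) :=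
  PDraw phi (@Ret (n.-tuple bool)).

Fixpoint compile (p : prog verdict) : procedure n m :=
  match p with
  | Ret v => Output n m v
  | PDraw phi k => Draw phi (fun x => compile (k x))
  | PAskSubCond phi b k => AskSubCond phi b (fun chi => compile (k chi))
  end.

Fixpoint draws A (p : prog A) : nat :=
  match p with
  | Ret _ => 0
  | PDraw _ k => (\max_(x : n.-tuple bool) draws (k x)).+1
  | PAskSubCond _ _ k => \max_(chi : m.-tuple bool) draws (k chi)
  end%N.

Lemma num_samples_compile (p : prog verdict) :
  num_samples (compile p) = draws p.
Proof.
elim: p => [v|phi k IH|phi b k IH] //=; last exact: eq_bigr.
by congr _.+1; apply: eq_bigr.
Qed.

Lemma draws_bind A B (p : prog A) (q : A -> prog B) d :
  (forall a, (draws (q a) <= d)%N) -> (draws (bind p q) <= draws p + d)%N.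
Proof.
move=> q_le; elim: p => [a|phi k IH|phi b k IH] //=.
- rewrite addSn ltnS; apply/bigmax_leqP => x _.
  by rewrite (leq_trans (IH x)) // leq_add2r leq_bigmax.
- apply/bigmax_leqP => chi _.
  by rewrite (leq_trans (IH chi)) // leq_add2r leq_bigmax.
Qed.

Lemma draws_map A B (f : A -> B) (p : prog A) : draws (prog_map f p) = draws p.
Proof.
rewrite /prog_map; elim: p => [a|phi k IH|phi b k IH] //=; last exact: eq_bigr.
by congr _.+1; apply: eq_bigr.
Qed.

Lemma draws_draw phi : draws (draw phi) = 1%N.
Proof. by rewrite /= big1. Qed.

End Programs.

Arguments Ret {n m A}.

Section Expectation.
Variables (R : realType) (n m : nat) (G : sr_sampler R n m).

Fixpoint expect A (p : prog n m A) (f : A -> R) : R :=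
  match p with
  | Ret a => f a
  | PDraw phi k => \sum_(x : n.-tuple bool) sr_dist G phi x * expect (k x) f
  | PAskSubCond phi b k => expect (k (SubCond G phi b)) f
  end.

Definition prob A (p : prog n m A) (a : pred A) : R :=
  expect p (fun x => (a x)%:R).

Lemma prob_output_compile (p : prog n m verdict) v :
  prob_output G v (compile p) = prob p (verdict_eqb^~ v).
Proof.
rewrite /prob; elim: p => [u|phi k IH|phi b k IH] //=.
by apply: eq_bigr => x _; rewrite IH.
Qed.

Lemma expect_bind A B (p : prog n m A) (q : A -> prog n m B) f :
  expect (bind p q) f = expect p (fun a => expect (q a) f).
Proof.
elim: p => [a|phi k IH|phi b k IH] //=.
by apply: eq_bigr => x _; rewrite IH.
Qed.

Lemma expect_map A B (g : A -> B) (p : prog n m A) f :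
  expect (prog_map g p) f = expect p (f \o g).
Proof. exact: expect_bind. Qed.

Lemma ler_expect A (p : prog n m A) f g :
  (forall a, f a <= g a) -> expect p f <= expect p g.
Proof.
move=> fg; elim: p => [a|phi k IH|phi b k IH] //=.
by apply: ler_sum => x _; rewrite ler_wpM2l ?pmf_ge0.
Qed.

Lemma eq_expect A (p : prog n m A) f g : f =1 g -> expect p f = expect p g.
Proof.
by move=> fg; apply/le_anti; rewrite !ler_expect // => a; rewrite fg.
Qed.

Lemma expect_cst A (p : prog n m A) c : expect p (fun=> c) = c.
Proof.
elim: p => [a|phi k IH|phi b k IH] //=.
by under eq_bigr do rewrite IH; rewrite -mulr_suml pmf_sum1 mul1r.
Qed.

Lemma expect_ge0 A (p : prog n m A) f : (forall a, 0 <= f a) -> 0 <= expect p f.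
Proof. by move=> f_ge0; rewrite -(expect_cst p 0) ler_expect. Qed.

Lemma expect_le1 A (p : prog n m A) f : (forall a, f a <= 1) -> expect p f <= 1.
Proof. by move=> f_le1; rewrite -[leRHS](expect_cst p) ler_expect. Qed.

Lemma expectZ A (p : prog n m A) c f :
  expect p (fun a => c * f a) = c * expect p f.
Proof.
elim: p => [a|phi k IH|phi b k IH] //=.
by rewrite mulr_sumr; apply: eq_bigr => x _; rewrite IH mulrCA.
Qed.

Lemma expectD A (p : prog n m A) f g :
  expect p (fun a => f a + g a) = expect p f + expect p g.
Proof.
elim: p => [a|phi k IH|phi b k IH] //=.
by rewrite -big_split; apply: eq_bigr => x _; rewrite IH mulrDr.
Qed.

Lemma expectB A (p : prog n m A) f g :
  expect p (fun a => f a - g a) = expect p f - expect p g.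
Proof.
rewrite -[- expect p g]mulN1r -expectZ -expectD.
by apply: eq_expect => a; rewrite mulN1r.
Qed.

Lemma expect_sqrB A (p : prog n m A) f c :
  expect p (fun a => (f a - c) ^+ 2)
    = expect p (fun a => f a ^+ 2) - 2 * c * expect p f + c ^+ 2.
Proof.
rewrite -expectZ -expectB -[c ^+ 2](expect_cst p) -expectD.
by apply: eq_expect => a; ring.
Qed.

Lemma sqr_expect_le A (p : prog n m A) f :
  expect p f ^+ 2 <= expect p (fun a => f a ^+ 2).
Proof.
have := expect_ge0 p (fun a => sqr_ge0 (f a - expect p f)).
by rewrite expect_sqrB; lra.
Qed.

Lemma expect_relative_variance A (p : prog n m A) f mu :
  mu != 0 -> expect p f = mu ->
  expect p (fun a => (f a / mu - 1) ^+ 2)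
    = expect p (fun a => f a ^+ 2) / mu ^+ 2 - 1.
Proof.
move=> mu_neq0 mean_f; rewrite expect_sqrB.
have -> : expect p (fun a => (f a / mu) ^+ 2)
    = expect p (fun a => f a ^+ 2) / mu ^+ 2.
  by rewrite mulrC -expectZ; apply: eq_expect => a; rewrite exprMn exprVn mulrC.
have -> : expect p (fun a => f a / mu) = 1.
  rewrite -[RHS](mulVf mu_neq0) -[X in _ * X]mean_f -expectZ.
  by apply: eq_expect => a; rewrite mulrC.
by ring.
Qed.

Lemma eq_prob A (p : prog n m A) (a b : pred A) : a =1 b -> prob p a = prob p b.
Proof. by move=> ab; apply: eq_expect => x; rewrite ab. Qed.

Lemma probU_le A (p : prog n m A) (a b : pred A) :
  prob p (fun x => a x || b x) <= prob p a + prob p b.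
Proof.
rewrite -expectD; apply: ler_expect => x /=.
by rewrite -natrD ler_nat; case: (a x); case: (b x).
Qed.

Lemma prob_compl_le A (p : prog n m A) (a b : pred A) :
  (forall x, ~~ a x -> b x) -> 1 - prob p a <= prob p b.
Proof.
move=> ab; rewrite -[X in X - _](expect_cst p) -expectB.
apply: ler_expect => x; have := ab x.
by case: (a x) => [_|->] //; rewrite ?subrr ?subr0.
Qed.

Lemma markov_prob A (p : prog n m A) (f : A -> R) c :
  0 < c -> (forall a, 0 <= f a) -> prob p (fun a => c <= f a) <= expect p f / c.
Proof.
move=> c_gt0 f_ge0; rewrite mulrC -expectZ; apply: ler_expect => a.
rewrite mulrC; case: (leP c (f a)) => [|_]; last by rewrite divr_ge0 // ltW.
by rewrite ler_pdivlMr // mul1r.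
Qed.

End Expectation.

Section EmpiricalMean.
Variables (n m : nat) (A : Type) (p : prog n m A).

Fixpoint iid_sum (V : nmodType) (f : A -> V) (t : nat) : prog n m V :=
  if t is t'.+1 then
    bind p (fun a => prog_map (+%R (f a)) (iid_sum f t'))
  else Ret 0.

Definition empirical_mean (R : realType) (f : A -> R) (t : nat) : prog n m R :=
  prog_map (fun S => S / t%:R) (iid_sum f t).

Lemma draws_iid_sum (V : nmodType) (f : A -> V) t :
  (draws (iid_sum f t) <= t * draws p)%N.
Proof.
elim: t => //= t IH; rewrite mulSn; apply: draws_bind => a.
by rewrite draws_map.
Qed.

Lemma draws_empirical_mean (R : realType) (f : A -> R) t :
  (draws (empirical_mean f t) <= t * draws p)%N.
Proof. by rewrite draws_map draws_iid_sum. Qed.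

Variables (R : realType) (G : sr_sampler R n m) (f : A -> R).
Let mu : R := expect G p f.

Lemma expect_iid_sum t : expect G (iid_sum f t) id = t%:R * mu.
Proof.
elim: t => [|t IH] /=; first by rewrite mul0r.
rewrite expect_bind.
under eq_expect do rewrite expect_map expectD expect_cst IH.
by rewrite expectD expect_cst -natr1 -/mu; ring.
Qed.

Lemma expect_iid_sum_sqr t :
  expect G (iid_sum f t) (fun S => S ^+ 2)
    = t%:R * expect G p (fun a => f a ^+ 2) + (t%:R ^+ 2 - t%:R) * mu ^+ 2.
Proof.
elim: t => [|t IH] /=; first by rewrite expr0n /= subrr !mul0r addr0.
have sqr_step a :
    expect G (prog_map (+%R (f a)) (iid_sum f t)) (fun S => S ^+ 2)
      = f a ^+ 2 + 2 * (t%:R * mu) * f a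
          + expect G (iid_sum f t) (fun S => S ^+ 2).
  rewrite expect_map -[f a ^+ 2](expect_cst G (iid_sum f t)).
  rewrite -expect_iid_sum mulrAC -expectZ -!expectD.
  by apply: eq_expect => S /=; ring.
rewrite expect_bind (eq_expect _ _ sqr_step) !expectD expectZ expect_cst IH.
by rewrite -/mu -natr1; ring.
Qed.

Lemma expect_empirical_mean t : (0 < t)%N ->
  expect G (empirical_mean f t) id = mu.
Proof.
rewrite lt0n -(pnatr_eq0 R) => t_neq0; rewrite expect_map.
under eq_expect do rewrite /= mulrC.
by rewrite expectZ expect_iid_sum mulKf.
Qed.

Lemma expect_empirical_mean_sqr t : (0 < t)%N ->
  expect G (empirical_mean f t) (fun M => M ^+ 2)
    = mu ^+ 2 + (expect G p (fun a => f a ^+ 2) - mu ^+ 2) / t%:R.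
Proof.
rewrite lt0n -(pnatr_eq0 R) => t_neq0; rewrite expect_map.
under eq_expect do rewrite /= exprMn mulrC.
by rewrite expectZ expect_iid_sum_sqr; field.
Qed.

Lemma expect_expR_iid_sum s t :
  expect G (iid_sum f t) (fun S => expR (s * S))
    = expect G p (fun a => expR (s * f a)) ^+ t.
Proof.
elim: t => [|t IH] /=; first by rewrite mulr0 expR0.
rewrite expect_bind exprSr -expectZ; apply: eq_expect => a.
rewrite expect_map -IH mulrC -expectZ.
by apply: eq_expect => S /=; rewrite mulrDr expRD.
Qed.

Hypothesis f_itv : forall a, 0 <= f a <= 1.

Lemma expect_expR_centered_le s : `|s| <= 2^-1 ->
  expect G p (fun a => expR (s * (f a - mu))) <= expR (2 * s ^+ 2).
Proof.
move=> s_le.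
have mu_itv : 0 <= mu <= 1.
  by apply/andP; split; [apply: expect_ge0 | apply: expect_le1] => a;
    have /andP[] := f_itv a.
have expR_le a : expR (s * (f a - mu)) <= (1 + 2 * s ^+ 2 - s * mu) + s * f a.
  have dev_le1 : `|f a - mu| <= 1 by have := f_itv a; rewrite ler_norml; lra.
  have sdev_le : s * (f a - mu) <= 2^-1.
    by rewrite (le_trans (ler_norm _)) // normrM (le_trans _ s_le) // ler_piMr.
  apply: le_trans (expR_le1DxD2sqr sdev_le) _.
  suff : (s * (f a - mu)) ^+ 2 <= s ^+ 2 by lra.
  by rewrite exprMn ler_piMr ?sqr_ge0 // -real_normK ?num_real // expr_le1.
apply: le_trans (ler_expect _ _ expR_le) _.
by rewrite expectD expect_cst expectZ -/mu subrK expR_ge1Dx.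
Qed.

Lemma expect_expR_le s : `|s| <= 2^-1 ->
  expect G p (fun a => expR (s * f a)) <= expR (s * mu + 2 * s ^+ 2).
Proof.
move=> s_le; rewrite expRD.
have -> : expect G p (fun a => expR (s * f a))
    = expR (s * mu) * expect G p (fun a => expR (s * (f a - mu))).
  by rewrite -expectZ; apply: eq_expect => a; rewrite -expRD; congr expR; ring.
by rewrite ler_wpM2l ?expR_ge0 // expect_expR_centered_le.
Qed.

(* The sign [e] covers the upper and the lower tail at once. *)
Lemma empirical_mean_tail e theta t :
  `|e| = 1 -> 0 <= theta <= 2 -> (0 < t)%N ->
  prob G (empirical_mean f t) (fun M => theta <= e * (M - mu))
    <= expR (- (t%:R * theta ^+ 2 / 8)).
Proof.
move=> e_unit theta_itv; rewrite -(ltr0n R) => t_gt0.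
(* [theta / 4] minimises the exponent [2 s^2 - s theta]. *)
pose s := e * (theta / 4).
have s_norm : `|s| = theta / 4 by rewrite normrM e_unit mul1r ger0_norm //; lra.
pose level := t%:R * (s * mu + theta ^+ 2 / 4).
apply: (@le_trans _ _
    (prob G (iid_sum f t) (fun S => expR level <= expR (s * S)))).
  rewrite /prob expect_map; apply: ler_expect => S /=.
  case: (leP theta _) => // theta_le; rewrite ler_nat lt0b ler_expR.
  have -> : s * S = t%:R * (theta / 4) * (e * (S / t%:R)).
    by rewrite /s; field; rewrite gt_eqF.
  have -> : level = t%:R * (theta / 4) * (e * mu + theta).
    by rewrite /level /s; field.
  by rewrite ler_wpM2l ?mulr_ge0 //; lra.
apply: le_trans (markov_prob _ _ _ _) _ => [|S|];
  rewrite ?expR_gt0 ?expR_ge0 //.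
have s_le : `|s| <= 2^-1 by lra.
rewrite expect_expR_iid_sum -expRN.
apply: (@le_trans _ _ (expR (s * mu + 2 * s ^+ 2) ^+ t * expR (- level))).
  rewrite ler_wpM2r ?expR_ge0 // lerXn2r ?nnegrE ?expR_ge0 ?expect_expR_le //.
  by apply: expect_ge0 => a; apply: expR_ge0.
rewrite -expRM_natl -expRD ler_expR /level.
have -> : s ^+ 2 = (theta / 4) ^+ 2 by rewrite -real_normK ?num_real // s_norm.
by lra.
Qed.

Lemma empirical_mean_deviation theta t : 0 <= theta <= 2 -> (0 < t)%N ->
  prob G (empirical_mean f t) (fun M => theta <= `|M - mu|)
    <= 2 * expR (- (t%:R * theta ^+ 2 / 8)).
Proof.
move=> theta_itv t_gt0.
rewrite (eq_prob _ _ (b := fun M => (theta <= 1 * (M - mu))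
                              || (theta <= -1 * (M - mu)))); last first.
  by move=> M; rewrite /= mul1r mulN1r ler_normr.
apply: le_trans (probU_le _ _ _ _) _; rewrite mulr2n mulrDl !mul1r.
by apply: lerD; apply: empirical_mean_tail; rewrite ?normrN ?normr1.
Qed.

End EmpiricalMean.

Section PrefixProducts.
Variable R : comPzSemiRingType.
Implicit Types (q r : seq bool -> bool -> R) (b s : seq bool).

Definition prefix_prod q b s : R :=
  \prod_(i < size s) q (b ++ take i s) (nth false s i).

Lemma prefix_prod_nil q b : prefix_prod q b [::] = 1.
Proof. exact: big_ord0. Qed.

Lemma prefix_prod_cons q b c s :
  prefix_prod q b (c :: s) = q b c * prefix_prod q (rcons b c) s.
Proof.
rewrite /prefix_prod big_ord_recl /= cats0; congr (_ * _).
by apply: eq_bigr => i _; rewrite cat_rcons.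
Qed.

Lemma prefix_prodM q r b s :
  prefix_prod (fun b c => q b c * r b c) b s
    = prefix_prod q b s * prefix_prod r b s.
Proof. exact: big_split. Qed.

Lemma sum_prefix_prod n q M b : (forall b, q b true + q b false = M) ->
  \sum_(x : n.-tuple bool) prefix_prod q b x = M ^+ n.
Proof.
move=> qM; elim: n b => [|n IH] b.
  rewrite (eq_bigr (fun=> 1)) => [|x _]; last by rewrite tuple0 prefix_prod_nil.
  by rewrite sumr_const card_tuple expr0.
pose cons_bit (cx : bool * n.-tuple bool) := [tuple of cx.1 :: cx.2].
rewrite (reindex cons_bit) /=; last first.
  exists (fun x : n.+1.-tuple bool => (thead x, [tuple of behead x])).
    by case=> c x _; congr (_, _); apply/val_inj.
  by move=> x _; rewrite /cons_bit -tuple_eta.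
under eq_bigr do rewrite prefix_prod_cons.
rewrite -(pair_bigA _ (fun c (x : n.-tuple bool) =>
  q b c * prefix_prod q (rcons b c) x)).
by rewrite big_bool /= -!mulr_sumr !IH -mulrDl qM exprS.
Qed.

End PrefixProducts.

Section Subcubes.
Variable n : nat.

Definition bit_set (i : nat) (c : bool) : {set n.-tuple bool} :=
  [set x : n.-tuple bool | nth false x i == c].

Lemma bit_set_false i : bit_set i false = ~: bit_set i true.
Proof. by apply/setP => x; rewrite !inE; case: nth. Qed.

Lemma subcube_nil : subcube n [::] = setT.
Proof. by apply/setP => x; rewrite !inE prefix0s. Qed.

Lemma subcube_full (x : n.-tuple bool) : subcube n x = [set x].
Proof.
by apply/setP => y; rewrite !inE prefixE size_tuple take_oversize ?size_tuple.
Qed.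

Lemma subcube_rcons b c : (size b < n)%N ->
  subcube n (rcons b c) = bit_set (size b) c :&: subcube n b.
Proof.
move=> b_lt; apply/setP => x; rewrite !inE !prefixE size_rcons.
by rewrite (take_nth false) ?size_tuple // eqseq_rcons andbC.
Qed.

End Subcubes.

Section ChainRule.
Variables (R : realType) (n m : nat) (G : sr_sampler R n m).
Variable psi : m.-tuple bool.
Let P := sr_dist G psi.

Lemma Pr_SubCond b (A : {set n.-tuple bool}) : (size b <= n)%N ->
  Pr P (subcube n b) * Pr (sr_dist G (SubCond G psi b)) A
    = Pr P (A :&: subcube n b).
Proof.
move=> b_le; have [cube0|cube_neq0] := eqVneq (Pr P (subcube n b)) 0.
  rewrite cube0 mul0r; apply/esym/le_anti.
  by rewrite Pr_ge0 andbT -cube0 le_Pr // subsetIr.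
rewrite {2}/Pr mulr_sumr (big_setID (subcube n b)) /=.
rewrite [X in _ + X]big1 ?addr0 => [|x].
  apply: eq_bigr => x; rewrite inE => /andP[_ x_cube].
  by rewrite SubCondP // /cond_subcube x_cube (negbTE cube_neq0) mulrC divfK.
rewrite inE => /andP[x_cube _].
by rewrite SubCondP // /cond_subcube x_cube mulr0.
Qed.

Definition bit_prob (b : seq bool) (c : bool) : R :=
  Pr (sr_dist G (SubCond G psi b)) (bit_set n (size b) c).

Lemma bit_prob_ge0 b c : 0 <= bit_prob b c.
Proof. exact: Pr_ge0. Qed.

Lemma bit_probD b : bit_prob b true + bit_prob b false = 1.
Proof. by rewrite /bit_prob bit_set_false Pr_setC. Qed.

Lemma Pr_subcube_cat b s : (size b + size s <= n)%N ->
  Pr P (subcube n (b ++ s)) = Pr P (subcube n b) * prefix_prod bit_prob b s.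
Proof.
elim: s b => [|c s IH] b /=; first by rewrite cats0 prefix_prod_nil mulr1.
rewrite addnS => bs_lt; have b_lt : (size b < n)%N.
  by rewrite (leq_trans _ bs_lt) // ltnS leq_addr.
rewrite -cat_rcons IH ?size_rcons ?addSn // subcube_rcons //.
by rewrite -Pr_SubCond ?(ltnW b_lt) // prefix_prod_cons mulrA.
Qed.

Lemma sr_dist_prefix_prod x : P x = prefix_prod bit_prob [::] x.
Proof.
have /= := @Pr_subcube_cat [::] x; rewrite size_tuple add0n => /(_ (leqnn n)).
by rewrite subcube_full Pr_set1 subcube_nil Pr_setT mul1r.
Qed.

End ChainRule.

Section ProbabilityEstimate.
Variables (R : realType) (n m : nat) (psi : m.-tuple bool) (N : nat).

Definition bit_frequency phi i c : prog n m R :=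
  empirical_mean (draw n phi) (fun x => (x \in bit_set n i c)%:R) N.

Fixpoint estimate (b s : seq bool) : prog n m R :=
  if s is c :: s' then
    PAskSubCond psi b (fun phi => bind (bit_frequency phi (size b) c)
      (fun freq => prog_map ( *%R freq) (estimate (rcons b c) s')))
  else Ret 1.

Lemma draws_bit_frequency phi i c : (draws (bit_frequency phi i c) <= N)%N.
Proof. by rewrite -[leqRHS]muln1 -(draws_draw n phi) draws_empirical_mean. Qed.

Lemma draws_estimate b s : (draws (estimate b s) <= size s * N)%N.
Proof.
elim: s b => //= c s IH b; apply/bigmax_leqP => phi _; rewrite mulSn.
apply: leq_trans (draws_bind _ (d := size s * N) _) _ => [freq|].
  by rewrite draws_map.
by rewrite leq_add2r draws_bit_frequency.
Qed.

Variable G : sr_sampler R n m.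
Hypothesis N_gt0 : (0 < N)%N.
Let P := sr_dist G psi.
Let q := bit_prob G psi.

Lemma expect_bit_frequency phi i c :
  expect G (bit_frequency phi i c) id = Pr (sr_dist G phi) (bit_set n i c).
Proof. by rewrite expect_empirical_mean //; apply: Pr_indicator. Qed.

Lemma expect_bit_frequency_sqr_le phi i c :
  expect G (bit_frequency phi i c) (fun freq => freq ^+ 2)
    <= Pr (sr_dist G phi) (bit_set n i c)
         * (Pr (sr_dist G phi) (bit_set n i c) + N%:R^-1).
Proof.
have indicator_sqr :
    expect G (draw n phi) (fun x => (x \in bit_set n i c)%:R ^+ 2)
      = Pr (sr_dist G phi) (bit_set n i c).
  rewrite -Pr_indicator; apply: eq_bigr => x _.
  by case: (x \in _); rewrite ?expr1n ?expr0n.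
rewrite expect_empirical_mean_sqr // indicator_sqr [expect _ _ _]Pr_indicator.
rewrite mulrDr -expr2 lerD2l ler_wpM2r ?invr_ge0 // gerBl.
exact: sqr_ge0.
Qed.

Lemma expect_estimate b s : expect G (estimate b s) id = prefix_prod q b s.
Proof.
elim: s b => [|c s IH] b /=; first by rewrite prefix_prod_nil.
rewrite prefix_prod_cons expect_bind.
rewrite -[q b c]expect_bit_frequency mulrC -expectZ.
by apply: eq_expect => freq; rewrite expect_map expectZ IH mulrC.
Qed.

Lemma expect_estimate_sqr_le b s :
  expect G (estimate b s) (fun r => r ^+ 2)
    <= prefix_prod q b s * prefix_prod (fun b c => q b c + N%:R^-1) b s.
Proof.
rewrite -prefix_prodM; elim: s b => [|c s IH] b /=.
  by rewrite expr1n prefix_prod_nil.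
rewrite prefix_prod_cons expect_bind.
pose tail_sqr := expect G (estimate (rcons b c) s) (fun r => r ^+ 2).
rewrite (eq_expect _ _ (g := fun freq => tail_sqr * freq ^+ 2)); last first.
  move=> freq; rewrite expect_map mulrC -expectZ.
  by apply: eq_expect => r; rewrite /= exprMn.
rewrite expectZ mulrC.
by apply: ler_pM (expect_bit_frequency_sqr_le _ _ _) (IH _);
  apply: expect_ge0 => r; apply: sqr_ge0.
Qed.

(* The weight [P x] absorbs one of the two divisions by [P x], and the second
   moment of the estimate absorbs the other. *)
Lemma estimate_chi2_le (x : n.-tuple bool) :
  P x * expect G (estimate [::] x) (fun r => (r / P x - 1) ^+ 2)
    <= prefix_prod (fun b c => q b c + N%:R^-1) [::] x - P x.
Proof.
have [x_eq0|x_neq0] := eqVneq (P x) 0.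
  rewrite x_eq0 mul0r subr0 prodr_ge0 // => i _.
  by rewrite addr_ge0 ?bit_prob_ge0 ?invr_ge0.
have x_gt0 : 0 < P x by rewrite lt_def x_neq0 pmf_ge0.
have P_prod : P x = prefix_prod q [::] x by apply: sr_dist_prefix_prod.
have mean_est : expect G (estimate [::] x) id = P x by rewrite expect_estimate.
rewrite (expect_relative_variance x_neq0 mean_est) mulrBr mulr1 lerD2r.
rewrite -(ler_pM2l x_gt0) [leLHS](_ : _ =
  expect G (estimate [::] x) (fun r => r ^+ 2)); last by field.
by rewrite [X in X * _]P_prod expect_estimate_sqr_le.
Qed.

Lemma sum_estimate_chi2_le :
  \sum_(x : n.-tuple bool)
      P x * expect G (estimate [::] x) (fun r => (r / P x - 1) ^+ 2)
    <= (1 + 2 / N%:R) ^+ n - 1.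
Proof.
rewrite -[X in _ - X](pmf_sum1 P).
rewrite -(@sum_prefix_prod _ n (fun b c => q b c + N%:R^-1) _ [::]).
  by rewrite -sumrB; apply: ler_sum => x _; apply: estimate_chi2_le.
by move=> b; rewrite addrACA bit_probD mulr2n mulrDl !mul1r.
Qed.

End ProbabilityEstimate.

Section DistanceAsExcess.
Variable R : realType.

Definition relative_excess (w g : R) : R := if w < g then 1 - w / g else 0.

Lemma relative_excess_itv w g : 0 <= w -> 0 <= relative_excess w g <= 1.
Proof.
move=> w_ge0; rewrite /relative_excess.
case: ltP => [w_lt|_]; last by rewrite lexx ler01.
have g_gt0 : 0 < g by apply: le_lt_trans w_lt.
rewrite subr_ge0 lerBlDr lerDl divr_ge0 ?(ltW g_gt0) //.
by rewrite ler_pdivrMr // mul1r ltW.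
Qed.

Lemma mul_relative_excess w g : 0 <= w ->
  g * relative_excess w g = Num.max 0 (g - w).
Proof.
move=> w_ge0; rewrite /relative_excess; case: ltP => [w_lt|g_le].
  have g_gt0 : 0 < g by apply: le_lt_trans w_lt.
  by rewrite mulrBr mulr1 mulrC divfK ?gt_eqF // max_r // subr_ge0 ltW.
by rewrite mulr0 max_l // subr_le0.
Qed.

(* At [g = 0] the bound is 1, since division by 0 gives 0. *)
Lemma relative_excess_lipschitz w g r : 0 <= w -> 0 <= g ->
  `|relative_excess w r - relative_excess w g| <= `|r / g - 1|.
Proof.
move=> w_ge0; rewrite le0r => /predU1P[->|g_gt0].
  have -> : relative_excess w 0 = 0 by rewrite /relative_excess ltNge w_ge0.
  rewrite invr0 mulr0 sub0r normrN normr1 subr0.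
  by have /andP[? ?] := relative_excess_itv r w_ge0; rewrite ger0_norm.
have -> : r / g - 1 = (r - g) / g by field; rewrite gt_eqF.
rewrite normrM normfV (gtr0_norm g_gt0) ler_pdivlMr // /relative_excess.
case: (ltP w r) => [w_lt_r|r_le_w]; case: (ltP w g) => [w_lt_g|g_le_w].
- have r_gt0 : 0 < r by apply: le_lt_trans w_lt_r.
  have -> : 1 - w / r - (1 - w / g) = w / r * ((r - g) / g).
    by field; rewrite !gt_eqF.
  rewrite normrM (normrM (r - g)) normfV (gtr0_norm g_gt0).
  rewrite mulrA divfK ?gt_eqF // ler_piMl //.
  by rewrite ger0_norm ?divr_ge0 ?(ltW r_gt0) // ler_pdivrMr // mul1r ltW.
- have r_gt0 : 0 < r by apply: le_lt_trans w_lt_r.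
  have g_le_r : g <= r by apply: le_trans g_le_w (ltW w_lt_r).
  have ratio_le1 : w / r <= 1 by rewrite ler_pdivrMr // mul1r ltW.
  rewrite subr0 !ger0_norm ?subr_ge0 //.
  apply: (@le_trans _ _ ((1 - w / r) * r)).
    by rewrite ler_wpM2l ?subr_ge0.
  by rewrite mulrBl divfK ?gt_eqF // mul1r lerD2l lerN2.
- have r_le_g : r <= g by apply: le_trans r_le_w (ltW w_lt_g).
  have ratio_le1 : w / g <= 1 by rewrite ler_pdivrMr // mul1r ltW.
  rewrite sub0r normrN (distrC r) !ger0_norm ?subr_ge0 //.
  by rewrite mulrBl divfK ?gt_eqF // mul1r lerD2l lerN2.
- by rewrite subr0 normr0 mul0r.
Qed.

Lemma dTV_sum_max n m (G W : sampler R n m) psi :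
  dTV G W psi = \sum_x Num.max 0 (G psi x - W psi x).
Proof.
apply/le_anti/andP; split.
  apply: bigmax_le => [|A _].
    by apply: sumr_ge0 => x _; rewrite le_max lexx.
  rewrite /Pr -sumrB [leLHS]big_mkcond; apply: ler_sum => x _.
  by case: ifP => _; rewrite le_max lexx ?orbT.
apply: (bigmax_sup [set x | W psi x <= G psi x]) => //.
rewrite /Pr -sumrB [leRHS]big_mkcond; apply: ler_sum => x _.
rewrite inE ge_max; case: (leP (W psi x) (G psi x)) => [W_le_G|/ltW G_le_W].
  by rewrite lexx subr_ge0 W_le_G.
by rewrite lexx subr_le0 G_le_W.
Qed.

Lemma dTV_relative_excess n m (G W : sampler R n m) psi :
  dTV G W psi = \sum_x G psi x * relative_excess (W psi x) (G psi x).
Proof.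
rewrite dTV_sum_max; apply: eq_bigr => x _.
by rewrite mul_relative_excess ?pmf_ge0.
Qed.

Lemma dTV_dim0 m (G W : sampler R 0 m) psi : dTV G W psi = 0.
Proof.
have pmf_eq1 (D : fdist R (0.-tuple bool)) x : D x = 1.
  rewrite -(pmf_sum1 D) (big_pred1 x) // => y /=.
  by rewrite [y]tuple0 [x]tuple0 eqxx.
by rewrite dTV_sum_max big1 // => x _; rewrite !pmf_eq1 subrr maxxx.
Qed.

End DistanceAsExcess.

Section DistanceEstimator.
Variables (R : realType) (n m : nat) (W : sr_sampler R n m).
Variables (psi : m.-tuple bool) (N : nat).

Definition trial : prog n m (n.-tuple bool * R) :=
  bind (draw n psi) (fun x => prog_map (pair x) (estimate R n psi N [::] x)).

Definition trial_excess (xr : n.-tuple bool * R) : R :=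
  relative_excess (sr_dist W psi xr.1) xr.2.

Definition distance_estimate (t : nat) : prog n m R :=
  empirical_mean trial trial_excess t.

Lemma draws_trial : (draws trial <= (n * N).+1)%N.
Proof.
rewrite -[(n * N).+1]add1n -(draws_draw n psi); apply: draws_bind => x.
by rewrite draws_map (leq_trans (draws_estimate _ _ _ _ _ _)) // size_tuple.
Qed.

Lemma draws_distance_estimate t :
  (draws (distance_estimate t) <= t * (n * N).+1)%N.
Proof.
apply: leq_trans (draws_empirical_mean _ _ _) _.
by rewrite leq_mul2l draws_trial orbT.
Qed.

Variable G : sr_sampler R n m.
Hypothesis N_gt0 : (0 < N)%N.
Let P := sr_dist G psi.
Let dist := dTV G W psi.
Let mu := expect G trial trial_excess.

Lemma expect_trial (f : n.-tuple bool * R -> R) :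
  expect G trial f
    = \sum_x P x * expect G (estimate R n psi N [::] x) (fun r => f (x, r)).
Proof. by rewrite expect_bind; apply: eq_bigr => x _; rewrite expect_map. Qed.

Lemma sqr_trial_bias_le : (mu - dist) ^+ 2 <= (1 + 2 / N%:R) ^+ n - 1.
Proof.
have -> : dist
    = expect G trial (fun xr => relative_excess (sr_dist W psi xr.1) (P xr.1)).
  rewrite /dist dTV_relative_excess expect_trial.
  by apply: eq_bigr => x _; rewrite /= expect_cst.
rewrite -expectB; apply: le_trans (sqr_expect_le _ _ _) _.
apply: le_trans (sum_estimate_chi2_le psi G N_gt0).
rewrite -(expect_trial (fun xr => (xr.2 / P xr.1 - 1) ^+ 2)).
apply: ler_expect => xr.
rewrite -[leLHS]real_normK ?num_real // -[leRHS]real_normK ?num_real //.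
by rewrite lerXn2r ?nnegrE // relative_excess_lipschitz ?pmf_ge0.
Qed.

Lemma trial_bias_le (gap : R) : 0 < gap <= 1 -> 64 * n%:R / gap ^+ 2 <= N%:R ->
  `|mu - dist| <= gap / 4.
Proof.
move=> /andP[gap_gt0 gap_le1].
have gap2_gt0 : 0 < gap ^+ 2 by rewrite exprn_gt0.
rewrite ler_pdivrMr // => N_ge.
have N_gt0R : 0 < N%:R :> R by rewrite ltr0n.
rewrite -ler_sqr ?nnegrE ?divr_ge0 ?(ltW gap_gt0) // real_normK ?num_real //.
apply: le_trans sqr_trial_bias_le _; rewrite lerBlDl.
have exponent_le : n%:R * (2 / N%:R) <= gap ^+ 2 / 32.
  by rewrite mulrA ler_pdivrMr //; lra.
have gap2_le1 : gap ^+ 2 <= 1 by rewrite expr_le1 // ltW.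
apply: le_trans (expr1D_le _ _) _; rewrite ?divr_ge0 //; lra.
Qed.

Lemma distance_estimate_deviation (gap delta : R) t :
  0 < gap <= 1 -> 0 < delta -> (0 < t)%N ->
  64 * n%:R / gap ^+ 2 <= N%:R -> 128 * ln (2 / delta) / gap ^+ 2 <= t%:R ->
  prob G (distance_estimate t) (fun M => gap / 2 <= `|M - dist|) <= delta.
Proof.
move=> gap_itv delta_gt0 t_gt0 N_ge t_ge; have /andP[gap_gt0 _] := gap_itv.
have bias : `|mu - dist| <= gap / 4 by apply: trial_bias_le.
apply: (@le_trans _ _
    (prob G (distance_estimate t) (fun M => gap / 4 <= `|M - mu|))).
  apply: ler_expect => M; rewrite ler_nat.
  case: (leP (gap / 2)) => // dev_ge.
  have triangle := ler_distD mu M dist.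
  by rewrite (_ : gap / 4 <= _) //; lra.
have excess_itv xr : 0 <= trial_excess xr <= 1.
  exact/relative_excess_itv/pmf_ge0.
have gap4_itv : 0 <= gap / 4 <= 2 by lra.
apply: le_trans (empirical_mean_deviation trial G excess_itv gap4_itv t_gt0) _.
rewrite mulrC -ler_pdivlMr // -[leRHS]lnK ?posrE ?divr_gt0 // ler_expR.
have -> : ln (delta / 2) = - ln (2 / delta).
  by rewrite -lnV ?posrE ?divr_gt0 // invf_div.
rewrite lerN2; move: t_ge; rewrite ler_pdivrMr ?exprn_gt0 //; lra.
Qed.

End DistanceEstimator.

Section Tester.
Variables (R : realType) (n m : nat).

Definition threshold_verdict (c M : R) : verdict :=
  if M <= c then ACCEPT else REJECT.

Definition threshold_test (eps eta : R) (p : prog n m R) : procedure n m :=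
  compile (prog_map (threshold_verdict ((eps + eta) / 2)) p).

Lemma threshold_test_correct (G : sr_sampler R n m) p eps eta delta dist :
  prob G p (fun M => (eta - eps) / 2 <= `|M - dist|) <= delta ->
  let success v := prob_output G v (threshold_test eps eta p) in
  (dist <= eps -> 1 - delta <= success ACCEPT) /\
  (eta <= dist -> 1 - delta <= success REJECT).
Proof.
set far_off := (X in prob G p X) => dev_le success.
have accurate v :
    (forall M, `|M - dist| < (eta - eps) / 2 ->
       verdict_eqb (threshold_verdict ((eps + eta) / 2) M) v) ->
    1 - delta <= success v.
  move=> v_correct; rewrite /success prob_output_compile /prob expect_map.
  apply: le_trans (prob_compl_le G p (a := far_off) _) => [|M].
    by rewrite lerD2l lerN2.
  by rewrite -ltNge; apply: v_correct.
by split=> dist_cmp; apply: accurate => M; rewrite ltr_norml => /andP[? ?];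
  rewrite /threshold_verdict; case: (leP M) => //; lra.
Qed.

Definition probes (gap : R) : nat := (Num.truncn (64 * n%:R / gap ^+ 2)).+1.

Definition trials (gap delta : R) : nat :=
  (Num.truncn (128 * ln (2 / delta) / gap ^+ 2)).+1.

(* In dimension 0 the distance is 0, and the sample bound leaves no draw. *)
Definition cube_probe_tester (eps eta delta : R) : tester R n m :=
  fun W psi => if n == 0%N then Output n m ACCEPT
               else threshold_test eps eta (distance_estimate W psi
                 (probes (eta - eps)) (trials (eta - eps) delta)).

End Tester.

Lemma identity_tester_cube_probe (R : realType) n m (eps eta delta : R) :
  0 < eps -> eps < eta -> eta < 1 -> 0 < delta ->
  identity_tester eps eta delta (@cube_probe_tester R n m eps eta delta).
Proof.
move=> eps_gt0 eps_lt eta_lt1 delta_gt0 G W psi.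
rewrite /cube_probe_tester /close /far.
case: n G W => [|n] G W; first by rewrite dTV_dim0 /=; split; lra.
apply: threshold_test_correct.
by apply: distance_estimate_deviation => //; [lra | exact/ltW/truncnS_gt..].
Qed.

Section SampleComplexity.
Variable R : realType.

Lemma truncnS_le (x : R) : 0 <= x -> (Num.truncn x).+1%:R <= x + 1.
Proof. by move=> x_ge0; rewrite -[leLHS]natr1 lerD2r truncn_le. Qed.

Lemma ln_two_div_le (delta y : R) :
  0 < delta -> delta^-1 <= y -> ln (2 / delta) <= 2 * ln (2 + y).
Proof.
move=> delta_gt0 y_ge.
have y_gt0 : 0 < y by apply: lt_le_trans y_ge; rewrite invr_gt0.
rewrite [leRHS]mulr_natl -lnXn ?addr_gt0 //.
rewrite ler_ln ?posrE ?divr_gt0 ?exprn_gt0 ?addr_gt0 //.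
by have := sqr_ge0 y; rewrite sqrrD; lra.
Qed.

Lemma trials_le (gap delta y : R) :
  0 < gap <= 1 -> 0 < delta < 1 -> delta^-1 <= y ->
  (trials gap delta)%:R <= 258 * ln (2 + y) / gap ^+ 2.
Proof.
move=> /andP[gap_gt0 gap_le1] /andP[delta_gt0 delta_lt1] y_ge.
have gap2_gt0 : 0 < gap ^+ 2 by rewrite exprn_gt0.
have gap2_le1 : gap ^+ 2 <= 1 by rewrite expr_le1 // ltW.
have ln_le := ln_two_div_le delta_gt0 y_ge.
have ln_ge : 2^-1 <= ln (2 + y).
  by rewrite ln_ge_half // lerDl (le_trans _ y_ge) // invr_ge0 ltW.
have confidence_ge0 : 0 <= ln (2 / delta).
  by rewrite ln_ge0 // ler_pdivlMr // mul1r; lra.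
apply: le_trans (truncnS_le _) _; first by rewrite divr_ge0 ?sqr_ge0 ?mulr_ge0.
by rewrite ler_pdivlMr // mulrDl divfK ?gt_eqF //; lra.
Qed.

Lemma draws_per_trial_le n (gap : R) : (0 < n)%N -> 0 < gap <= 1 ->
  (n * probes n gap).+1%:R <= 66 * (n%:R ^+ 2 / gap ^+ 2).
Proof.
move=> n_gt0 /andP[gap_gt0 gap_le1].
have n_ge1 : 1 <= n%:R :> R by rewrite ler1n.
have gap2_gt0 : 0 < gap ^+ 2 by rewrite exprn_gt0.
have gap2_le1 : gap ^+ 2 <= 1 by rewrite expr_le1 // ltW.
have probes_le : (probes n gap)%:R * gap ^+ 2 <= 65 * n%:R.
  apply: le_trans (ler_wpM2r (ltW gap2_gt0) (truncnS_le _)) _.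
    by rewrite divr_ge0 ?sqr_ge0 ?mulr_ge0.
  by rewrite mulrDl divfK ?gt_eqF //; lra.
rewrite -natr1 natrM mulrA ler_pdivlMr // mulrDl mul1r -mulrA.
have := ler_wpM2l (ler0n R n) probes_le.
have : 1 <= n%:R ^+ 2 :> R by rewrite expr_ge1.
lra.
Qed.

Lemma num_samples_cube_probe_le n m (W : sr_sampler R n m) psi
    (eps eta delta : R) :
  0 < eta - eps <= 1 -> 0 < delta < 1 ->
  (num_samples (cube_probe_tester eps eta delta W psi))%:R
    <= 17028 * (n%:R ^+ 2 / (eta - eps) ^+ 4)
         * ln (2 + n%:R / ((eta - eps) * delta)).
Proof.
rewrite /cube_probe_tester; set gap := eta - eps => gap_itv delta_itv.
have [->|n_neq0] := eqVneq n 0%N; first by rewrite expr0n /= mul0r mulr0 mul0r.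
have /andP[gap_gt0 gap_le1] := gap_itv; have /andP[delta_gt0 _] := delta_itv.
have n_gt0 : (0 < n)%N by rewrite lt0n.
have confidence_le : delta^-1 <= n%:R / (gap * delta).
  rewrite invfM mulrA ler_peMl ?invr_ge0 ?(ltW delta_gt0) //.
  by rewrite ler_pdivlMr // mul1r (le_trans gap_le1) // ler1n.
set L := ln _.
have -> : 17028 * (n%:R ^+ 2 / gap ^+ 4) * L
    = (258 * L / gap ^+ 2) * (66 * (n%:R ^+ 2 / gap ^+ 2)).
  by field; rewrite gt_eqF.
rewrite num_samples_compile draws_map.
apply: (@le_trans _ _ ((trials gap delta)%:R * (n * probes n gap).+1%:R)).
  by rewrite -natrM ler_nat draws_distance_estimate.
by rewrite ler_pM ?trials_le ?draws_per_trial_le.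
Qed.

End SampleComplexity.

Theorem theorem3 (R : realType) :
  exists (T : forall (n m : nat) (eps eta delta : R), tester R n m)
         (C : R) (k : nat),
    forall (n m : nat) (eps eta delta : R),
      0 < eps < 1 -> 0 < eta < 1 -> eps < eta -> 0 < delta < 1 ->
      identity_tester eps eta delta (T n m eps eta delta) /\
      forall (W : sr_sampler R n m) (psi : m.-tuple bool),
        (num_samples (T n m eps eta delta W psi))%:R
          <= C * (n%:R ^+ 2 / (eta - eps) ^+ 4)
               * ln (2 + n%:R / ((eta - eps) * delta)) ^+ k.
Proof.
exists (@cube_probe_tester R), 17028, 1%N.
move=> n m eps eta delta /andP[eps_gt0 _] /andP[_ eta_lt1] eps_lt_eta delta_itv.
split=> [|W psi].
  by apply: identity_tester_cube_probe => //; case/andP: delta_itv.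
by rewrite expr1; apply: num_samples_cube_probe_le => //; lra.
Qed.
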